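(* Let $\mu\in\mathbb{R}$, $\sigma>0$, $S_0>0$ be constants, let $\tilde\mu=\mu-\sigma^2/2$, and let $(S_t)_{t\ge 0}$ be the geometric Brownian motion $S_t=S_0\exp(\tilde\mu t+\sigma B_t)$. Let $T$ be a nonnegative random variable independent of the Brownian motion $(B_t)_{t\ge0}$, with moment-generating function $M_T(s)=E[\exp(sT)]$. Then for every $m=0,1,2,\ldots$, $$E[S_T^m]=S_0^m\,M_T\!\left(m\tilde\mu+\frac{m^2}{2}\sigma^2\right),$$ and the moment $E[S_T^m]$ diverges (equals $+\infty$) if $s=m\tilde\mu+m^2\sigma^2/2$ lies outside the domain of $M_T(s)$.
   Context: $(B_t)_{t\ge0}$ is a standard one-dimensional Brownian motion with $B_0=0$. $S_t$ is the It\^o solution of $dS_t=\mu S_t\,dt+\sigma S_t\,dB_t$ started at the positive constant $S_0$. $S_T$ denotes the value of the process at the random observation time $T$. The domain of $M_T$ is the set of real $s$ for which $E[\exp(sT)]<\infty$. *)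

(* Defs.v *)
From HB Require Import structures.
From mathcomp Require Import all_boot all_order all_algebra.
From mathcomp Require Import all_classical all_reals all_analysis.
Set Implicit Arguments.
Unset Strict Implicit.
Unset Printing Implicit Defensive.
Import Order.TTheory GRing.Theory Num.Theory.
Import numFieldNormedType.Exports.
Local Open Scope classical_set_scope.
Local Open Scope ring_scope.

(* Processes are indexed by all of [R]; only times t >= 0 are ever constrained
   or used, so the values at negative times are irrelevant. *)

(* Mutual independence of a finite family. Taking some of the [A i] to be
   [setT] yields the product rule for every subfamily. *)
Definition mutually_independent (d : measure_display) (Omega : measurableType d)
    (R : realType) (P : probability Omega R) (I : finType)
    (X : I -> Omega -> R) : Prop :=
  forall A : I -> set R, (forall i, measurable (A i)) ->
    P (\bigcap_(i in [set: I]) (X i @^-1` A i)) =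
    (\prod_(i : I) P (X i @^-1` A i))%E.

Definition independent_increments (d : measure_display)
    (Omega : measurableType d) (R : realType) (P : probability Omega R)
    (B : R -> {RV P >-> R}) : Prop :=
  forall (n : nat) (t : nat -> R), 0 <= t 0%N ->
    (forall i, (i < n)%N -> t i <= t i.+1) ->
    mutually_independent P (fun i : 'I_n => B (t i.+1) \- B (t i)).

(* The law is compared with N(0, t - s) on measurable sets only: both sides
   are functions of arbitrary sets, with no meaning off the Borel sets.
   The second argument of [normal_prob] is the standard deviation. *)
Definition gaussian_increments (d : measure_display)
    (Omega : measurableType d) (R : realType) (P : probability Omega R)
    (B : R -> {RV P >-> R}) : Prop :=
  forall s t : R, 0 <= s -> s < t -> forall A : set R, measurable A ->
    pushforward P (B t \- B s) A = normal_prob 0 (Num.sqrt (t - s)) A.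

Record standard_brownian_motion (d : measure_display)
    (Omega : measurableType d) (R : realType) (P : probability Omega R)
    (B : R -> {RV P >-> R}) : Prop := StandardBrownianMotion {
  sbm_start : {ae P, forall w, B 0 w = 0} ;
  sbm_independent : independent_increments B ;
  sbm_gaussian : gaussian_increments B ;
  sbm_continuous :
    {ae P, forall w, {within `[0, +oo[, continuous (fun t : R => B t w)}} }.

(* The sigma-algebra generated by the whole process (B_t)_{t >= 0}. *)
Definition process_sigma_algebra (d : measure_display)
    (Omega : measurableType d) (R : realType) (P : probability Omega R)
    (B : R -> {RV P >-> R}) : set (set Omega) :=
  <<s [set E | exists t : R, exists A : set R,
         [/\ 0 <= t, measurable A & E = B t @^-1` A] ]>>.

Definition independent_of_process (d : measure_display)
    (Omega : measurableType d) (R : realType) (P : probability Omega R)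
    (T : {RV P >-> R}) (B : R -> {RV P >-> R}) : Prop :=
  forall (A : set R) (E : set Omega), measurable A ->
    process_sigma_algebra B E ->
    P ((T @^-1` A) `&` E) = (P (T @^-1` A) * P E)%E.

Definition geometric_brownian_motion (d : measure_display)
    (Omega : measurableType d) (R : realType) (P : probability Omega R)
    (mu sigma S0 : R) (B : R -> {RV P >-> R}) (t : R) (w : Omega) : R :=
  S0 * expR ((mu - sigma ^+ 2 / 2) * t + sigma * B t w).

(* S_T. When paths of S are continuous only almost surely, S_T agrees with a
   random variable off a null set, and ['E_P] of a nonnegative function,
   being defined as a supremum over simple functions below it, does not see
   that null set. *)
Definition at_random_time (Omega : Type) (R : realType)
    (S : R -> Omega -> R) (T : Omega -> R) (w : Omega) : R := S (T w) w.

Definition mgf_domain (d : measure_display) (Omega : measurableType d)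
    (R : realType) (P : probability Omega R) (T : Omega -> R) : set R :=
  [set s | ('M_P T s < +oo)%E].

(* Main.v *)
Require Import Defs.
From HB Require Import structures.
From mathcomp Require Import all_boot all_order all_algebra ring.
From mathcomp Require Import all_classical all_reals all_analysis.
From mathcomp Require Import measurable_realfun.
Set Implicit Arguments.
Unset Strict Implicit.
Unset Printing Implicit Defensive.
Import Order.TTheory GRing.Theory Num.Theory.
Import numFieldNormedType.Exports.
Local Open Scope classical_set_scope.
Local Open Scope ring_scope.

(** Conditionally on T = t, the m-th moment of S_T is that of S_t, which is
    S0^m exp(s t) with s = m mut + m^2 sigma^2 / 2, since B_t is centred
    Gaussian with variance t ([brownian_mgf]). Averaging over T gives
    S0^m M_T(s), an identity in [0, +oo], so that the divergence claim is the
    case where the right-hand side is infinite.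

    The substance is the conditioning step
    ([expectation_at_independent_time]): if X is a nonnegative process with
    almost surely continuous paths and each X_t is independent of T, then
    E[X_T] = E[Phi(T)] where Phi(t) = E[X_t]. A joint measurability argument
    on the product of the law of T with the path space is avoided by
    discretising T. When T takes countably many values, one splits the
    expectation along the events where T is constant
    ([integral_countable_index]) and uses independence on each of them
    ([integral_independent_event]). A general T is the limit of its roundings
    T_n down to the grid of mesh 1/(n+1); path continuity gives X_(T_n) -> X_T
    and Phi(T_n) -> Phi(T), and dominated convergence applies when X is
    bounded. An unbounded X is reached by truncating it at the level K and
    letting K grow, by monotone convergence on both sides.

    Since paths are continuous only off a null set, X_T itself may fail to be
    measurable. Every passage to the limit therefore takes place on a
    measurable set of full measure, to which integrals of nonnegative functions
    can be restricted without any measurability ([ge0_integral_conull]). *)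

(** * Integration of nonnegative functions *)

Section conull.
Import HBNNSimple.

(** The integral of a nonnegative function is a supremum over the simple
    functions below it; multiplying such a simple function by the indicator of
    D leaves its integral unchanged, so that f may be non-measurable. *)
Lemma ge0_integral_conull d (T : measurableType d) (R : realType)
    (mu : {measure set T -> \bar R}) (D : set T) (f : T -> \bar R) :
  measurable D -> mu (~` D) = 0%E -> (forall x, (0 <= f x)%E) ->
  (\int[mu]_(x in D) f x = \int[mu]_x f x)%E.
Proof.
move=> mD D0 f0; have mDC : measurable (~` D) by exact: measurableC.
have fD0 x : (0 <= (f \_ D) x)%E by rewrite erestrict_ge0.
rewrite integral_mkcond !ge0_integralTE//; apply/eqP; rewrite eq_le.
apply/andP; split.
  apply: ereal_sup_le => _ [h hf <-].
  exists h => // x; apply: (le_trans (hf x)).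
  by rewrite patchE; case: ifPn.
apply: ge_ereal_sup => _ [h hf <-].
rewrite -integralT_nnsfun.
rewrite (ge0_negligible_integral mDC)//=; last first.
- by move=> x _; rewrite lee_fin.
- exact/measurable_EFinP.
rewrite setDE setTI setCK (integral_nnsfun _ mD).
apply: ereal_sup_ubound; exists (proj_nnsfun h mD); last first.
  by rewrite mrestrict.
move=> x; rewrite /= -[h x * _]/(proj_nnsfun h mD x) -mrestrict !patchE.
by case: ifPn.
Qed.

End conull.

Lemma ge0_integral_law d d' (T : measurableType d) (Y : measurableType d')
    (R : realType) (mu : {measure set T -> \bar R})
    (nu : {measure set Y -> \bar R}) (X : T -> Y) (f : Y -> \bar R) :
  measurable_fun setT X -> measurable_fun setT f -> (forall y, (0 <= f y)%E) ->
  (forall A, measurable A -> mu (X @^-1` A) = nu A) ->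
  (\int[mu]_w f (X w) = \int[nu]_y f y)%E.
Proof.
move=> mX mf f0 law.
transitivity (\int[pushforward mu X]_y f y)%E.
  by rewrite (ge0_integral_pushforward mX).
by apply: (eq_measure_integral nu) => A mA _; exact: law.
Qed.

(** Restricting P to E and scaling P by P(E) give the same law to X. The
    absolute value appears because the change of variables along X requires an
    integrand that is nonnegative on the whole line. *)
Lemma integral_independent_event d (T : measurableType d) (R : realType)
    (P : probability T R) (E : set T) (X : T -> R) :
  measurable E -> measurable_fun setT X -> (forall w, 0 <= X w) ->
  (forall C : set R, measurable C ->
    P (E `&` X @^-1` C) = (P E * P (X @^-1` C))%E) ->
  (\int[P]_(w in E) (X w)%:E = P E * \int[P]_w (X w)%:E)%E.
Proof.
move=> mE mX X0 EX.
have PE0 : 0 <= fine (P E) by rewrite fine_ge0.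
have Pfin : P E \is a fin_num by exact: fin_num_measure.
have X0E w : (0 <= (X w)%:E)%E by rewrite lee_fin.
transitivity (\int[mrestr P mE]_(w in E) (X w)%:E)%E.
  by apply: eq_measure_integral => A mA AE; rewrite /= /mrestr setIidl.
rewrite ge0_integral_conull//; last first.
  by rewrite /= /mrestr setICl measure0.
have push (m : {measure set T -> \bar R}) :
    (\int[m]_w (X w)%:E = \int[pushforward m X]_y (`|y|%:E))%E.
  rewrite (ge0_integral_pushforward mX)//=.
  - by apply: eq_integral => w _; rewrite ger0_norm.
  - by apply/measurable_EFinP; exact: normr_measurable.
rewrite !push -[X in (_ = X * _)%E](fineK Pfin).
rewrite -[fine (P E)]/((NngNum PE0)%:num) -ge0_integral_mscale//; last first.
  by apply/measurable_EFinP; exact: normr_measurable.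
apply: eq_measure_integral => C mC _.
transitivity (P (X @^-1` C `&` E)); first by [].
by rewrite setIC EX// -[X in (X * _)%E](fineK Pfin).
Qed.

(** A family sampled at a random index with countably many values is measurable
    and can be integrated piece by piece. *)
Lemma integral_countable_index d (T : measurableType d) (R : realType)
    (mu : {measure set T -> \bar R}) (K : T -> nat) (f : nat -> T -> \bar R) :
  (forall k, measurable (K @^-1` [set k])) ->
  (forall k, measurable_fun setT (f k)) -> (forall k x, (0 <= f k x)%E) ->
  measurable_fun setT (fun x => f (K x) x) /\
  (\int[mu]_x f (K x) x =
   \sum_(0 <= k <oo) \int[mu]_(x in K @^-1` [set k]) f k x)%E.
Proof.
move=> mK mf f0.
have KT : \bigcup_k (K @^-1` [set k]) = setT.
  by apply/seteqP; split => // x _; exists (K x).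
have mfK : measurable_fun setT (fun x => f (K x) x).
  rewrite -KT; apply/measurable_fun_bigcup => // k.
  apply: (@eq_measurable_fun _ _ _ _ _ (f k)).
    by move=> x /[!inE] /= ->.
  exact: measurable_funTS.
split=> //; rewrite -[X in (\int[_]_(_ in X) _)%E]KT.
rewrite ge0_integral_bigcup// ?KT//.
- apply: eq_eseriesr => k _; apply: eq_integral => x.
  by rewrite inE => /= ->.
- by apply/trivIsetP => i j _ _ ij; apply/seteqP; split=> // x [/= -> /eqP];
    rewrite (negbTE ij).
Qed.

(** * Rounding a time down to a grid *)

Definition grid_floor (R : realType) (n : nat) (t : R) : R :=
  (Num.truncn (n.+1%:R * t))%:R / n.+1%:R.

Lemma grid_floor_ge0 (R : realType) (n : nat) (t : R) : 0 <= grid_floor n t.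
Proof. by rewrite divr_ge0. Qed.

Lemma cvg_grid_floor (R : realType) (t : R) : 0 <= t ->
  grid_floor n t @[n --> \oo] --> t.
Proof.
move=> t0; apply: (@squeeze_cvgr _ _ _ _ (fun n => t - n.+1%:R^-1) (cst t)).
- apply: nearW => n; have n0 : 0 < n.+1%:R :> R by [].
  have /truncn_itv/andP[lo hi] : 0 <= n.+1%:R * t by rewrite mulr_ge0.
  rewrite /grid_floor ler_pdivlMr// ler_pdivrMr// mulrBl mulVf ?gt_eqF//.
  rewrite /cst (mulrC t) lo andbT lerBlDr natr1.
  exact: ltW.
- rewrite -[X in _ --> X]subr0; apply: cvgB; first exact: cvg_cst.
  exact: cvg_harmonic.
- exact: cvg_cst.
Qed.

(** Continuity is only assumed relative to nonnegative times, hence the sign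
    condition on the approximating sequence. *)
Lemma cvg_within_seq (R : realType) (f : R -> R) (u : nat -> R) (t : R) :
  {within `[0, +oo[, continuous f} -> (forall n, 0 <= u n) -> 0 <= t ->
  u n @[n --> \oo] --> t -> f (u n) @[n --> \oo] --> f t.
Proof.
move=> /subspace_continuousP fc u0 t0 ut.
have ft : f @ within `[0, +oo[ (nbhs t) --> f t.
  by apply: fc; rewrite /= in_itv/= t0.
apply: cvg_trans ft => A /= fA.
have uA : \forall n \near \oo, `[0, +oo[%classic (u n) -> A (f (u n)).
  exact: ut _ fA.
suff : \forall n \near \oo, A (f (u n)) by [].
apply: filterS uA => n; apply.
by rewrite /= in_itv/= u0.
Qed.

(** * Truncation *)

Lemma cvg_EFin_seq (R : realType) (u : nat -> R) (l : R) :
  u n @[n --> \oo] --> l -> ((u n)%:E @[n --> \oo] --> l%:E)%E.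
Proof. by move=> ul; apply/fine_cvgP; split=> //; exact: nearW. Qed.

Lemma cvg_min_natr (R : realType) (x : R) :
  Num.min K%:R x @[K --> \oo] --> x.
Proof.
apply: cvg_near_cst; near=> K; apply/min_idPr.
by near: K; exact: nbhs_infty_ger.
Unshelve. all: by end_near. Qed.

Lemma cvg_integral_min_natr d (T : measurableType d) (R : realType)
    (mu : {measure set T -> \bar R}) (D : set T) (f : T -> R) :
  measurable D ->
  (forall K : nat, measurable_fun D (fun x => (Num.min K%:R (f x))%:E)) ->
  (forall x, 0 <= f x) ->
  (\int[mu]_(x in D) (Num.min K%:R (f x))%:E @[K --> \oo] -->
   \int[mu]_(x in D) (f x)%:E)%E.
Proof.
move=> mD mf f0.
rewrite (_ : (\int[mu]_(x in D) (f x)%:E =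
    \int[mu]_(x in D) limn (fun K => (Num.min K%:R (f x))%:E))%E).
  apply: cvg_monotone_convergence => //.
  - by move=> K x _; rewrite lee_fin le_min f0 ler0n.
  - by move=> x _ K L KL; rewrite lee_fin le_min2 ?ler_nat.
apply: eq_integral => x _; apply/esym/cvg_lim => //.
exact/cvg_EFin_seq/cvg_min_natr.
Qed.

(** * Evaluation of a process at an independent time *)

Definition independent_rv d (Omega : measurableType d) (R : realType)
    (P : probability Omega R) (Y X : Omega -> R) : Prop :=
  forall A C : set R, measurable A -> measurable C ->
    P (Y @^-1` A `&` X @^-1` C) = (P (Y @^-1` A) * P (X @^-1` C))%E.

Section freezing.
Context d (Omega : measurableType d) (R : realType) (P : probability Omega R).
Variable T : {RV P >-> R}.
Hypothesis T_ge0 : forall w, 0 <= T w.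

(** The conditioning identity when the time only takes the values k / (n+1):
    both sides are sums over k, and on the event where the time is k / (n+1)
    independence factors the k-th term. *)
Lemma expectation_grid_time (n : nat) (X : R -> Omega -> R) :
  (forall t, measurable_fun setT (X t)) -> (forall t w, 0 <= X t w) ->
  (forall t, 0 <= t -> independent_rv P T (X t)) ->
  [/\ measurable_fun setT (fun w => (X (grid_floor n (T w)) w)%:E),
      measurable_fun setT
        (fun w => \int[P]_v (X (grid_floor n (T w)) v)%:E)%E &
      (\int[P]_w (X (grid_floor n (T w)) w)%:E =
       \int[P]_w \int[P]_v (X (grid_floor n (T w)) v)%:E)%E].
Proof.
move=> mX X0 indX.
pose K w := Num.truncn (n.+1%:R * T w).
have KE k : K @^-1` [set k] =
    T @^-1` `[k%:R / n.+1%:R, k.+1%:R / n.+1%:R[%classic.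
  apply/seteqP; split=> w /=; rewrite in_itv/=.
    move=> <-; rewrite ler_pdivrMr// ltr_pdivlMr// mulrC.
    by apply: truncn_itv; rewrite mulr_ge0.
  rewrite ler_pdivrMr// ltr_pdivlMr// mulrC => ?; exact: truncn_def.
have mK k : measurable (K @^-1` [set k]).
  by rewrite KE -[X in measurable X]setTI; exact: (measurable_funP T).
pose f k w := (X (k%:R / n.+1%:R) w)%:E.
have mf k : measurable_fun setT (f k) by apply/measurable_EFinP.
have f0 k x : (0 <= f k x)%E by rewrite lee_fin.
have [mfK intfK] := integral_countable_index P mK mf f0.
have Phi0 t : (0 <= \int[P]_v (X t v)%:E)%E.
  by apply: integral_ge0 => v _; rewrite lee_fin.
have mg k : measurable_fun setT
    (fun _ : Omega => \int[P]_v (X (k%:R / n.+1%:R) v)%:E)%E by [].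
have [mgK intgK] := integral_countable_index P mK mg (fun k _ => Phi0 _).
split; [exact: mfK|exact: mgK|].
transitivity (\int[P]_w f (K w) w)%E; first by [].
rewrite intfK; symmetry; apply: etrans; first exact: intgK.
apply: eq_eseriesr => k _.
rewrite integral_cst// muleC KE; symmetry.
apply: integral_independent_event => //; first by rewrite -KE.
by move=> C mC; apply: indX => //; rewrite divr_ge0.
Qed.

Variable D : set Omega.
Hypotheses (mD : measurable D) (D_conull : P (~` D) = 0%E).

(** Off D the limit Z is unrelated to the sequence and may be non-measurable:
    this is the situation of X_T, whose paths are only continuous on D. *)
Lemma cvg_expectation_bounded (Y : nat -> Omega -> \bar R) (Z : Omega -> \bar R)
    (C : R) :
  (forall n, measurable_fun setT (Y n)) -> (forall w, 0 <= Z w)%E ->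
  (forall n w, 0 <= Y n w <= C%:E)%E ->
  (forall w, D w -> Y n w @[n --> \oo] --> Z w) ->
  (\int[P]_w Y n w @[n --> \oo] --> \int[P]_w Z w)%E.
Proof.
move=> mY Z0 YC YZ; have Y0 n w : (0 <= Y n w)%E by have /andP[] := YC n w.
rewrite -(ge0_integral_conull mD)//.
under eq_fun => n do rewrite -(ge0_integral_conull mD)//.
apply: (@dominated_cvg _ _ _ _ _ mD _ _ (cst C%:E)) => //.
- by move=> n; exact: measurable_funTS.
- exact: finite_measure_integrable_cst.
- by move=> n w _; have /andP[_ ?] := YC n w; rewrite gee0_abs.
Qed.

(** Boundedness makes dominated convergence available both under E[X_t], so that
    Phi(T_n) tends to Phi(T) at every outcome, and then on each side of the
    identity at the rounded times T_n. *)
Lemma expectation_bounded_at_time (X : R -> Omega -> R) (C : R) :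
  (forall t, measurable_fun setT (X t)) -> (forall t w, 0 <= X t w <= C) ->
  (forall t, 0 <= t -> independent_rv P T (X t)) ->
  (forall w t, D w -> 0 <= t -> X (grid_floor n t) w @[n --> \oo] --> X t w) ->
  [/\ measurable_fun D (fun w => (X (T w) w)%:E),
      measurable_fun setT (fun w => \int[P]_v (X (T w) v)%:E)%E &
      (\int[P]_w (X (T w) w)%:E = \int[P]_w \int[P]_v (X (T w) v)%:E)%E].
Proof.
move=> mX XC indX cvgX.
have X0 t w : 0 <= X t w by have /andP[] := XC t w.
have X0E t w : (0 <= (X t w)%:E)%E by rewrite lee_fin.
have grid n := expectation_grid_time n mX X0 indX.
have cvgXT w : D w ->
    ((X (grid_floor n (T w)) w)%:E @[n --> \oo] --> (X (T w) w)%:E)%E.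
  by move=> Dw; apply/cvg_EFin_seq/cvgX.
have cvgPhi w : ((\int[P]_v (X (grid_floor n (T w)) v)%:E) @[n --> \oo] -->
    \int[P]_v (X (T w) v)%:E)%E.
  apply: (cvg_expectation_bounded (C := C)) => //.
  - by move=> n; apply/measurable_EFinP.
  - by move=> n v; rewrite !lee_fin.
  - by move=> v Dv; apply/cvg_EFin_seq/cvgX.
have Phi0 t : (0 <= \int[P]_v (X t v)%:E)%E by exact: integral_ge0.
have PhiC t : (\int[P]_v (X t v)%:E <= C%:E)%E.
  rewrite -[leRHS]mule1 -(@probability_setT _ _ _ P) -integral_cst//.
  apply: ge0_le_integral => //; first by apply/measurable_EFinP.
  by move=> v _; rewrite lee_fin; have /andP[] := XC t v.
split.
- apply: (emeasurable_fun_cvg _ _ _ cvgXT) => n.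
  by apply: measurable_funTS; have [] := grid n.
- apply: (emeasurable_fun_cvg _ _ _ (fun w _ => cvgPhi w)) => n.
  by have [] := grid n.
have left_lim : (\int[P]_w (X (grid_floor n (T w)) w)%:E @[n --> \oo] -->
    \int[P]_w (X (T w) w)%:E)%E.
  apply: (cvg_expectation_bounded (C := C)) => //.
  - by move=> n; have [] := grid n.
  - by move=> n w; rewrite !lee_fin.
have right_lim :
    (\int[P]_w \int[P]_v (X (grid_floor n (T w)) v)%:E @[n --> \oo] -->
     \int[P]_w \int[P]_v (X (T w) v)%:E)%E.
  apply: (cvg_expectation_bounded (C := C)) => //.
  - by move=> n; have [] := grid n.
  - by move=> n w; rewrite Phi0 PhiC.
apply: (cvg_unique _ left_lim) => //.
suff -> : (fun n => \int[P]_w (X (grid_floor n (T w)) w)%:E)%E =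
  (fun n => \int[P]_w \int[P]_v (X (grid_floor n (T w)) v)%:E)%E by [].
by apply/funext => n; have [] := grid n.
Qed.

(** Truncation at the level K preserves independence and path continuity, so the
    bounded case applies to min(K, X); both sides then increase with K. *)
Lemma expectation_at_independent_time (X : R -> Omega -> R) :
  (forall t, measurable_fun setT (X t)) -> (forall t w, 0 <= X t w) ->
  (forall t, 0 <= t -> independent_rv P T (X t)) ->
  (forall w, D w -> {within `[0, +oo[, continuous (X^~ w)}) ->
  (\int[P]_w (X (T w) w)%:E = \int[P]_w \int[P]_v (X (T w) v)%:E)%E.
Proof.
move=> mX X0 indX cX.
pose XK (K : nat) t w := Num.min K%:R (X t w).
have mmin K : measurable_fun setT (fun x : R => Num.min K%:R x).
  by apply: measurable_minr.
have mXK K t : measurable_fun setT (XK K t) by exact: measurableT_comp.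
have XKC K t w : 0 <= XK K t w <= K%:R.
  by rewrite /XK le_min X0 ler0n ge_min lexx.
have X0K K t w : (0 <= (XK K t w)%:E)%E.
  by rewrite lee_fin; have /andP[] := XKC K t w.
have indXK K t : 0 <= t -> independent_rv P T (XK K t).
  move=> t0 A C mA mC.
  apply: (indX t t0 A ((fun x : R => Num.min K%:R x) @^-1` C)) => //.
  by rewrite -[X in measurable X]setTI; exact: mmin.
have cvgXK K w t : D w -> 0 <= t ->
    XK K (grid_floor n t) w @[n --> \oo] --> XK K t w.
  move=> Dw t0.
  have cmin : {for X t w, continuous (fun x : R => Num.min K%:R x)}.
    by apply: continuous_min => //; exact: cvg_cst.
  apply: continuous_cvg cmin _.
  apply: (@cvg_within_seq _ (X^~ w)) => //; first exact: cX.
    by move=> n; exact: grid_floor_ge0.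
  exact: cvg_grid_floor.
have bounded K :=
  expectation_bounded_at_time (mXK K) (XKC K) (@indXK K) (@cvgXK K).
have left_lim : (\int[P]_w (XK K (T w) w)%:E @[K --> \oo] -->
    \int[P]_w (X (T w) w)%:E)%E.
  rewrite -(ge0_integral_conull mD)//.
  under eq_fun => K do rewrite -(ge0_integral_conull mD)//.
  - apply: cvg_integral_min_natr => // K.
    by have [] := bounded K.
  - by move=> w; rewrite lee_fin.
have Phi_lim t : (\int[P]_v (XK K t v)%:E @[K --> \oo] -->
    \int[P]_v (X t v)%:E)%E.
  apply: cvg_integral_min_natr => // K; apply/measurable_EFinP; exact: mXK.
have right_lim : (\int[P]_w \int[P]_v (XK K (T w) v)%:E @[K --> \oo] -->
    \int[P]_w \int[P]_v (X (T w) v)%:E)%E.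
  rewrite (_ : (\int[P]_w \int[P]_v (X (T w) v)%:E =
      \int[P]_w limn (fun K => \int[P]_v (XK K (T w) v)%:E))%E).
    apply: cvg_monotone_convergence => //.
    - by move=> K; have [] := bounded K.
    - by move=> K w _; apply: integral_ge0.
    - move=> w _ K L KL; apply: ge0_le_integral => //.
      + by apply/measurable_EFinP.
      + by apply/measurable_EFinP.
      + by move=> v _; rewrite lee_fin le_min2 ?ler_nat.
  by apply: eq_integral => w _; apply/esym/cvg_lim => //; exact: Phi_lim.
apply: (cvg_unique _ left_lim) => //.
suff -> : (fun K => \int[P]_w (XK K (T w) w)%:E)%E =
  (fun K => \int[P]_w \int[P]_v (XK K (T w) v)%:E)%E by [].
by apply/funext => K; have [] := bounded K.
Qed.

End freezing.

(** * Exponential moments of Brownian motion *)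

(** The density is almost everywhere equal to the Radon-Nikodym derivative with
    respect to Lebesgue measure, since both have the same integrals. *)
Lemma ge0_integral_normal_prob (R : realType) (m s : R) (f : R -> \bar R) :
  measurable_fun setT f -> (forall x, (0 <= f x)%E) ->
  (\int[normal_prob m s]_x f x =
   \int[lebesgue_measure]_x (f x * (normal_pdf m s x)%:E))%E.
Proof.
move=> mf f0; have dom := normal_prob_dominates m s.
have mRN : measurable_fun setT
    (Radon_Nikodym_SigmaFinite.f (normal_prob m s) lebesgue_measure).
  exact: measurable_int (Radon_Nikodym_SigmaFinite.f_integrable dom).
have mpdf : measurable_fun setT (fun x => (normal_pdf m s x)%:E).
  by apply/measurable_EFinP; exact: measurable_normal_pdf.
rewrite -(Radon_Nikodym_SigmaFinite.change_of_variables dom)//.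
apply: ae_eq_integral => //; try exact: emeasurable_funM.
apply: ae_eqe_mul2l; apply: integral_ae_eq => //.
- exact: Radon_Nikodym_SigmaFinite.f_integrable.
- move=> A _ mA; symmetry.
  exact: (Radon_Nikodym_SigmaFinite.f_integral dom mA).
Qed.

(** Completing the square: an exponential tilt of a centred Gaussian density is,
    up to a constant factor, a Gaussian density with a shifted mean. *)
Lemma normal_pdf_tilt (R : realType) (s b x : R) : s != 0 ->
  expR (b * x) * normal_pdf 0 s x =
  expR (b ^+ 2 * s ^+ 2 / 2) * normal_pdf (b * s ^+ 2) s x.
Proof.
move=> s0; rewrite !normal_pdfE// mulrCA [RHS]mulrCA; congr (_ * _).
by rewrite /normal_fun -!expRD; congr expR; field.
Qed.

Lemma normal_prob_mgf (R : realType) (s b : R) : s != 0 ->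
  (\int[normal_prob 0 s]_x (expR (b * x))%:E =
   (expR (b ^+ 2 * s ^+ 2 / 2))%:E)%E.
Proof.
move=> s0; have mexp : measurable_fun setT (fun x : R => (expR (b * x))%:E).
  by apply/measurable_EFinP; apply: measurableT_comp.
rewrite ge0_integral_normal_prob//.
transitivity (\int[lebesgue_measure]_x ((expR (b ^+ 2 * s ^+ 2 / 2))%:E *
    (normal_pdf (b * s ^+ 2) s x)%:E))%E.
  by apply: eq_integral => x _; rewrite -!EFinM normal_pdf_tilt.
rewrite ge0_integralZl_EFin ?expR_ge0//.
- by rewrite integral_normal_pdf mule1.
- by move=> x _; rewrite lee_fin normal_pdf_ge0.
- by apply/measurable_EFinP; exact: measurable_normal_pdf.
Qed.

(** The Gaussian law is only prescribed for increments over nondegenerate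
    intervals, so t = 0 is treated apart, through B_0 = 0; for t > 0 the
    increment over [0, t] is almost surely B_t. *)
Lemma brownian_mgf d (Omega : measurableType d) (R : realType)
    (P : probability Omega R) (B : R -> {RV P >-> R}) (b t : R) :
  standard_brownian_motion B -> 0 <= t ->
  (\int[P]_w (expR (b * B t w))%:E = (expR (b ^+ 2 * t / 2))%:E)%E.
Proof.
move=> hB; have mexp : measurable_fun setT (fun x : R => (expR (b * x))%:E).
  by apply/measurable_EFinP; apply: measurableT_comp.
have ge0_exp (x : R) : (0 <= (expR (b * x))%:E)%E by rewrite lee_fin expR_ge0.
have mB u : measurable_fun setT (fun w => (expR (b * B u w))%:E).
  by apply: (measurableT_comp mexp).
rewrite le_eqVlt => /predU1P[<-|t0].
  rewrite mulr0 mul0r expR0 -(@probability_setT _ _ _ P) -[RHS]mul1e.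
  rewrite -integral_cst//; apply: ge0_ae_eq_integral => //.
  by apply: filterS (sbm_start hB) => w B0 _; rewrite B0 mulr0 expR0.
have mBB : measurable_fun setT (B t \- B 0 : Omega -> measurableTypeR R).
  by apply: measurable_funB.
transitivity (\int[P]_w (expR (b * (B t w - B 0 w)))%:E)%E.
  apply: ge0_ae_eq_integral => //.
  - by apply: (measurableT_comp mexp mBB).
  - by apply: filterS (sbm_start hB) => w B0 _ /=; rewrite B0 subr0.
rewrite -[in RHS](sqr_sqrtr (ltW t0)) -normal_prob_mgf ?gt_eqF ?sqrtr_gt0//.
(* normal_prob lives on the line equipped with the sigma-algebra generated by
   half-open intervals, a structure with the same measurable sets as the default
   one but distinct from it. *)
pose f (x : measurableTypeR R) := (expR (b * x))%:E.
apply: (@ge0_integral_law _ _ _ _ _ _ _ _ f mBB) => //.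
by move=> A mA; have := sbm_gaussian hB (lexx 0) t0 mA; rewrite subr0.
Qed.

(** * Moments of geometric Brownian motion at an independent time *)

Theorem mainTheorem1 (d : measure_display) (Omega : measurableType d)
    (R : realType) (P : probability Omega R)
    (B : R -> {RV P >-> R}) (T : {RV P >-> R}) (mu sigma S0 : R)
    (hsigma : 0 < sigma) (hS0 : 0 < S0)
    (hB : standard_brownian_motion B)
    (hT : forall w, 0 <= T w)
    (hTB : independent_of_process T B) :
  let mut := mu - sigma ^+ 2 / 2 in
  let S := geometric_brownian_motion mu sigma S0 B in
  let S_T := at_random_time S T in
  forall m : nat,
    let s := m%:R * mut + m%:R ^+ 2 / 2 * sigma ^+ 2 in
    ('E_P[fun w => (S_T w ^+ m)%R] = (S0 ^+ m)%:E * 'M_P T s)%E /\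
    (~ mgf_domain P T s -> ('E_P[fun w => (S_T w ^+ m)%R] = +oo)%E).
Proof.
move=> mut S S_T m s.
have S0m : 0 < S0 ^+ m by rewrite exprn_gt0.
(* S_t^m is h t B_t; h is used for measurability and independence. *)
pose h t x : R := (S0 * expR (mut * t + sigma * x)) ^+ m.
have mh t : measurable_fun setT (h t).
  apply: measurable_funX; apply: measurable_funM => //.
  apply: measurableT_comp => //; apply: measurable_funD => //.
have SE t w : S t w ^+ m =
    (S0 ^+ m * expR (m%:R * mut * t)) * expR (m%:R * sigma * B t w).
  rewrite /S /geometric_brownian_motion exprMn -expRM_natl -[RHS]mulrA -expRD.
  by congr (_ * expR _); rewrite mulrDr !mulrA.
have SM t : 0 <= t ->
    (\int[P]_w (S t w ^+ m)%:E = (S0 ^+ m * expR (s * t))%:E)%E.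
  move=> t0; under eq_integral do rewrite SE EFinM.
  rewrite ge0_integralZl_EFin//.
  - rewrite (brownian_mgf _ hB t0) -EFinM; congr (_%:E).
    rewrite -[LHS]mulrA -expRD; congr (_ * expR _).
    by rewrite /s; field.
  - apply/measurable_EFinP; apply: measurableT_comp => //.
    exact: measurable_funM.
  - by rewrite mulr_ge0 ?expR_ge0// ltW.
have main : ('E_P[fun w => (S_T w ^+ m)%R] = (S0 ^+ m)%:E * 'M_P T s)%E.
  have [N [mN N0 subN]] := sbm_continuous hB.
  (* N is a measurable null set off which the paths are continuous. *)
  have mNC : measurable (~` N) by exact: measurableC.
  have NC0 : P (~` ~` N) = 0%E by rewrite setCK.
  rewrite /mmt_gen_fun !unlock /S_T /at_random_time.
  rewrite (@expectation_at_independent_time _ _ _ _ _ hT _ mNC NC0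
    (fun t w => S t w ^+ m)).
  - under eq_integral => w _ do rewrite SM// EFinM.
    rewrite ge0_integralZl_EFin ?(ltW S0m)//.
    + by congr (_ * _)%E; apply: eq_integral => w _ /=; rewrite mulrC.
    + apply/measurable_EFinP; apply: measurableT_comp => //.
      exact: measurable_funM.
  - by move=> t; exact: (measurableT_comp (mh t)).
  - by move=> t w; rewrite exprn_ge0// mulr_ge0 ?expR_ge0// ltW.
  - move=> t t0 A C mA mC; apply: (hTB A) => //.
    apply: sub_gen_smallest; exists t, (h t @^-1` C); split => //.
    by rewrite -[X in measurable X]setTI; exact: mh.
  - move=> w Nw.
    have cB : {within `[0, +oo[, continuous (fun t => B t w)}.
      by apply: contrapT => nc; apply: Nw; exact: subN.
    have ch : continuous (fun u : R => (S0 * expR u) ^+ m).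
      move=> u.
      apply: (@continuous_comp _ _ _ (fun u : R => S0 * expR u)
        (fun x : R => x ^+ m)); last exact: exprn_continuous.
      by apply: cvgM; [exact: cvg_cst|exact: continuous_expR].
    have cid : {within `[0, +oo[, continuous (fun t : R => t)}.
      by apply: continuous_subspaceT => x; exact: cvg_id.
    have cu : {within `[0, +oo[, continuous
        (fun t => mut * t + sigma * B t w)}.
      move=> t; apply: cvgD; apply: cvgM; try exact: cvg_cst.
      + exact: cid.
      + exact: cB.
    by move=> t; exact: continuous_cvg (ch _) (cu t).
split=> // sdom; rewrite main.
have -> : ('M_P T s = +oo)%E.
  by apply/eqP; rewrite -leye_eq leNgt; apply/negP.
by rewrite gt0_muley// lte_fin.
Qed.
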